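(* Let $M$ be a complete lattice which, as a $\mathbf{B}$-semimodule (with addition given by join), is projective. The following conditions are equivalent: (i) $\mathrm{CEnd}_{\mathbf{B}}(M)$ is ideal-simple; (ii) $\mathrm{CEnd}_{\mathbf{B}}(M)$ is simple; (iii) $\mathrm{CEnd}_{\mathbf{B}}(M)$ is congruence-simple; (iv) $M$ is a finite distributive lattice.
   Context: A semiring $(R,+,\cdot,0,1)$ consists of a commutative monoid $(R,+,0)$ and a monoid $(R,\cdot,1)$ such that multiplication distributes over addition on both sides and $0r=0=r0$ for all $r\in R$. An ideal is an additive submonoid closed under left and right multiplication by elements of $R$. A semiring $R$ is ideal-simple if $0$ and $R$ are its only ideals; congruence-simple if the diagonal and the universal relation $R^2$ are its only congruences; simple if it is both. $\mathbf{B}=\{0,1\}$ is the Boolean semifield ($1+1=1$); $\mathbf{B}$-semimodules are the same as idempotent commutative monoids $(M,+,0)$ (join-semilattices with least element). A $\mathbf{B}$-semimodule is projective if it is a retract of a free $\mathbf{B}$-semimodule (a direct sum of copies of $\mathbf{B}$). A complete lattice $M$ is regarded as a complete $\mathbf{B}$-semimodule via $\sum_{i\in\Omega}m_i=\bigvee_{i\in\Omega}m_i$. $\mathrm{CEnd}_{\mathbf{B}}(M)$ is the semiring of all maps $M\to M$ preserving arbitrary joins (including the empty join), with pointwise addition (join) and composition. *)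

(* Defs.v *)
From HB Require Import structures.
From mathcomp Require Import all_boot all_order all_algebra.
From mathcomp Require Import boolp classical_sets functions cardinality.

Set Implicit Arguments.
Unset Strict Implicit.
Unset Printing Implicit Defensive.

Import Order.TTheory GRing.Theory.
Local Open Scope classical_set_scope.
Local Open Scope ring_scope.

(* [pzSemiRingType] is the class of semirings in which [0 = 1] is allowed. *)
Section Simplicity.
Variable R : pzSemiRingType.

Definition is_ideal (I : set R) : Prop :=
  [/\ I 0, (forall x y, I x -> I y -> I (x + y))
    & (forall r x, I x -> I (r * x) /\ I (x * r))].

Definition ideal_simple : Prop :=
  forall I : set R, is_ideal I -> I = [set 0] \/ I = [set: R].

Definition is_congruence (E : R -> R -> Prop) : Prop :=
  [/\ (forall x, E x x), (forall x y, E x y -> E y x),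
      (forall x y z, E x y -> E y z -> E x z),
      (forall x x' y y', E x x' -> E y y' -> E (x + y) (x' + y'))
    & (forall x x' y y', E x x' -> E y y' -> E (x * y) (x' * y'))].

Definition congruence_simple : Prop :=
  forall E : R -> R -> Prop, is_congruence E ->
    (forall x y, E x y <-> x = y) \/ (forall x y, E x y).

Definition semiring_simple : Prop := ideal_simple /\ congruence_simple.

End Simplicity.

(* The direct sum of copies of [R] indexed by [X]. *)
Section DirectSum.
Variables (R : nzSemiRingType) (X : Type).

Record dsum := DSum {
  dsum_fun :> X -> R;
  dsum_finite : finite_set [set x | dsum_fun x != 0] }.

HB.instance Definition _ := gen_eqMixin dsum.
HB.instance Definition _ := gen_choiceMixin dsum.

Lemma dsum_eq (f g : dsum) : (forall x, f x = g x) -> f = g.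
Proof.
case: f g => [f fP] [g gP] /= /funext fg; subst g.
by congr DSum; exact: Prop_irrelevance.
Qed.

Lemma dsum_zero_finite : finite_set [set x : X | (0 : R) != 0].
Proof. by apply: (sub_finite_set _ (finite_set0 X)) => x /=; rewrite eqxx. Qed.

Definition dsum_zero : dsum := DSum dsum_zero_finite.

Lemma dsum_add_finite (f g : dsum) : finite_set [set x | f x + g x != 0].
Proof.
have fgfin : finite_set ([set x | f x != 0] `|` [set x | g x != 0]).
  by rewrite finite_setU; split; exact: dsum_finite.
apply: sub_finite_set fgfin => x /=.
have [->|] := eqVneq (f x) 0; last by left.
by rewrite add0r; right.
Qed.

Definition dsum_add (f g : dsum) : dsum := DSum (dsum_add_finite f g).

Lemma dsum_scale_finite (a : R) (f : dsum) :
  finite_set [set x | a * f x != 0].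
Proof.
apply: sub_finite_set (dsum_finite f) => x /=.
by apply: contra_neq => ->; rewrite mulr0.
Qed.

Definition dsum_scale (a : R) (f : dsum) : dsum := DSum (dsum_scale_finite a f).

Fact dsum_addA : associative dsum_add.
Proof. by move=> f g h; apply: dsum_eq => x /=; rewrite addrA. Qed.

Fact dsum_addC : commutative dsum_add.
Proof. by move=> f g; apply: dsum_eq => x /=; rewrite addrC. Qed.

Fact dsum_add0 : left_id dsum_zero dsum_add.
Proof. by move=> f; apply: dsum_eq => x /=; rewrite add0r. Qed.

HB.instance Definition _ :=
  GRing.isNmodule.Build dsum dsum_addA dsum_addC dsum_add0.

Fact dsum_scaleA a b f : dsum_scale a (dsum_scale b f) = dsum_scale (a * b) f.
Proof. by apply: dsum_eq => x /=; rewrite mulrA. Qed.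

Fact dsum_scale0 f : dsum_scale 0 f = 0.
Proof. by apply: dsum_eq => x /=; rewrite mul0r. Qed.

Fact dsum_scale1 : left_id 1 dsum_scale.
Proof. by move=> f; apply: dsum_eq => x /=; rewrite mul1r. Qed.

Fact dsum_scaleDr : right_distributive dsum_scale +%R.
Proof. by move=> a f g; apply: dsum_eq => x /=; rewrite mulrDr. Qed.

Fact dsum_scaleDl f : {morph dsum_scale^~ f : a b / a + b}.
Proof. by move=> a b; apply: dsum_eq => x /=; rewrite mulrDl. Qed.

HB.instance Definition _ := GRing.Nmodule_isLSemiModule.Build R dsum
  dsum_scaleA dsum_scale0 dsum_scale1 dsum_scaleDr dsum_scaleDl.

End DirectSum.

Definition projective (R : nzSemiRingType) (P : lSemiModType R) : Prop :=
  exists (X : Type) (i : {linear P -> dsum R X}) (p : {linear dsum R X -> P}),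
    cancel i p.

(* The Boolean semifield: [bool] with [orb] as addition, so that [1 + 1 = 1].
   The alias keeps it apart from [bool] with the exclusive or. *)
Definition Bsemifield : Type := bool.

HB.instance Definition _ := Choice.on Bsemifield.

Fact Bsemifield_1neq0 : (true : Bsemifield) != false. Proof. by []. Qed.

HB.instance Definition _ := GRing.isNmodule.Build Bsemifield
  (orbA : associative (orb : Bsemifield -> Bsemifield -> Bsemifield))
  orbC orFb.
HB.instance Definition _ := GRing.Nmodule_isPzSemiRing.Build Bsemifield
  (andbA : associative (andb : Bsemifield -> Bsemifield -> Bsemifield))
  andTb andbT andb_orl andb_orr andFb andbF.
HB.instance Definition _ :=
  GRing.PzSemiRing_isNonZero.Build Bsemifield Bsemifield_1neq0.

(* The semimodule over the Boolean semifield underlying a join-semilattice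
   with least element. *)
Section JoinSemimodule.
Context {d : Order.disp_t} (M : bJoinSemilatticeType d).

Definition join_semimod : Type := M.

HB.instance Definition _ := Choice.on join_semimod.

Let jadd : join_semimod -> join_semimod -> join_semimod := @Order.join d M.

HB.instance Definition _ := GRing.isNmodule.Build join_semimod
  (@joinA d M : associative jadd) (@joinC d M) (@join0x d M).

Definition join_scale (b : Bsemifield) (x : join_semimod) : join_semimod :=
  if b then x else 0.

Fact join_scaleA a b x : join_scale a (join_scale b x) = join_scale (a * b) x.
Proof. by case: a; case: b. Qed.

Fact join_scale0 x : join_scale 0 x = 0. Proof. by []. Qed.

Fact join_scale1 : left_id 1 join_scale. Proof. by []. Qed.

Fact join_scaleDr : right_distributive join_scale +%R.
Proof. by case=> x y //=; rewrite addr0. Qed.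

Fact join_scaleDl x : {morph join_scale^~ x : a b / a + b}.
Proof.
case=> [] [] /=; rewrite ?addr0 ?add0r //.
by rewrite [RHS](joinxx (x : M)).
Qed.

HB.instance Definition _ := GRing.Nmodule_isLSemiModule.Build
  Bsemifield join_semimod join_scaleA join_scale0 join_scale1
  join_scaleDr join_scaleDl.

End JoinSemimodule.

HB.mixin Record TBLattice_isComplete d M of Order.TBLattice d M := {
  cjoin : set M -> M;
  cjoin_supremums : forall A : set M, supremums A (cjoin A) }.

#[short(type="completeLatticeType")]
HB.structure Definition CompleteLattice d :=
  { M of Order.TBLattice d M & TBLattice_isComplete d M }.

Section CEnd.
Context {d : Order.disp_t} (M : completeLatticeType d).
Implicit Types A : set M.

Lemma cjoinP A (s : M) : supremums A s -> cjoin A = s.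
Proof.
move=> [As sA]; have [Ac cA] := cjoin_supremums A.
by apply/le_anti; rewrite (cA s As) (sA _ Ac).
Qed.

(* For [A = set0] the condition says that the least element is preserved. *)
Record CEnd := MkCEnd {
  CEnd_fun :> M -> M;
  CEnd_cjoin : forall A : set M, CEnd_fun (cjoin A) = cjoin (CEnd_fun @` A) }.

HB.instance Definition _ := gen_eqMixin CEnd.
HB.instance Definition _ := gen_choiceMixin CEnd.

Lemma CEnd_eq (f g : CEnd) : (forall x, f x = g x) -> f = g.
Proof.
case: f g => [f fP] [g gP] /= /funext fg; subst g.
by congr MkCEnd; exact: Prop_irrelevance.
Qed.

Lemma CEnd_supremums (f : CEnd) A : supremums (f @` A) (f (cjoin A)).
Proof. by rewrite CEnd_cjoin; exact: cjoin_supremums. Qed.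

Lemma CEnd_join (f : CEnd) (x y : M) :
  f (Order.join x y) = Order.join (f x) (f y).
Proof.
have sup2 (u v : M) : supremums [set u; v] (Order.join u v).
  split=> [z /= [] ->|z zU]; rewrite ?leUl ?leUr // leUx.
  by rewrite !zU //=; [right|left].
rewrite -(cjoinP (sup2 x y)) CEnd_cjoin; apply: cjoinP.
by rewrite image_setU !image_set1; exact: sup2.
Qed.

Lemma CEnd_bot (f : CEnd) : f \bot%O = \bot%O.
Proof.
have sup0 : supremums (set0 : set M) \bot%O.
  by split=> [z //|z _]; exact: le0x.
by rewrite -{1}(cjoinP sup0) CEnd_cjoin image_set0; exact: cjoinP.
Qed.

Fact CEnd_zero_subproof A : (\bot%O : M) = cjoin ((fun=> \bot%O : M) @` A).
Proof.
by apply/esym/cjoinP; split=> [_ [x _ <-]|z _]; [exact: lexx|exact: le0x].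
Qed.

Definition CEnd_zero : CEnd := MkCEnd CEnd_zero_subproof.

Fact CEnd_add_subproof (f g : CEnd) A :
  Order.join (f (cjoin A)) (g (cjoin A)) =
  cjoin ((fun x => Order.join (f x) (g x)) @` A).
Proof.
have [fU fL] := CEnd_supremums f A; have [gU gL] := CEnd_supremums g A.
apply/esym/cjoinP; split=> [_ [x Ax <-]|z zU].
  by apply: leU2; [apply: fU|apply: gU]; exists x.
rewrite leUx; apply/andP; split; [apply: fL|apply: gL] => _ [x Ax <-].
  by apply: le_trans (zU _ (ex_intro2 _ _ x Ax erefl)); rewrite ?leUl.
by apply: le_trans (zU _ (ex_intro2 _ _ x Ax erefl)); rewrite ?leUr.
Qed.

Definition CEnd_add (f g : CEnd) : CEnd := MkCEnd (CEnd_add_subproof f g).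

Fact CEnd_one_subproof A : cjoin A = cjoin ((fun x : M => x) @` A).
Proof. by rewrite image_id. Qed.

Definition CEnd_one : CEnd := MkCEnd CEnd_one_subproof.

Fact CEnd_mul_subproof (f g : CEnd) A :
  f (g (cjoin A)) = cjoin ((fun x => f (g x)) @` A).
Proof. by rewrite !CEnd_cjoin image_comp. Qed.

Definition CEnd_mul (f g : CEnd) : CEnd := MkCEnd (CEnd_mul_subproof f g).

Fact CEnd_addA : associative CEnd_add.
Proof. by move=> f g h; apply: CEnd_eq => x /=; rewrite joinA. Qed.

Fact CEnd_addC : commutative CEnd_add.
Proof. by move=> f g; apply: CEnd_eq => x /=; rewrite joinC. Qed.

Fact CEnd_add0 : left_id CEnd_zero CEnd_add.
Proof. by move=> f; apply: CEnd_eq => x /=; rewrite join0x. Qed.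

HB.instance Definition _ :=
  GRing.isNmodule.Build CEnd CEnd_addA CEnd_addC CEnd_add0.

Fact CEnd_mulA : associative CEnd_mul.
Proof. by move=> f g h; apply: CEnd_eq. Qed.

Fact CEnd_mul1l : left_id CEnd_one CEnd_mul.
Proof. by move=> f; apply: CEnd_eq. Qed.

Fact CEnd_mul1r : right_id CEnd_one CEnd_mul.
Proof. by move=> f; apply: CEnd_eq. Qed.

Fact CEnd_mulDl : left_distributive CEnd_mul +%R.
Proof. by move=> f g h; apply: CEnd_eq. Qed.

Fact CEnd_mulDr : right_distributive CEnd_mul +%R.
Proof. by move=> f g h; apply: CEnd_eq => x /=; rewrite CEnd_join. Qed.

Fact CEnd_mul0l : left_zero 0 CEnd_mul.
Proof. by move=> f; apply: CEnd_eq. Qed.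

Fact CEnd_mul0r : right_zero 0 CEnd_mul.
Proof. by move=> f; apply: CEnd_eq => x /=; rewrite CEnd_bot. Qed.

HB.instance Definition _ := GRing.Nmodule_isPzSemiRing.Build CEnd
  CEnd_mulA CEnd_mul1l CEnd_mul1r CEnd_mulDl CEnd_mulDr CEnd_mul0l CEnd_mul0r.

End CEnd.

Definition finite_distributive {d : Order.disp_t} (M : latticeType d) : Prop :=
  finite_set [set: M] /\ left_distributive (@Order.meet d M) Order.join.

(* Main.v *)
Require Import Defs.
From mathcomp Require Import all_boot all_order all_algebra.
From mathcomp Require Import boolp classical_sets cardinality.

Set Implicit Arguments.
Unset Strict Implicit.
Unset Printing Implicit Defensive.

Import Order.TTheory GRing.Theory.
Local Open Scope classical_set_scope.
Local Open Scope ring_scope.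

(* A splitting of a free semimodule onto M sends the top of M to a finite
   subset S of the basis. Hence the element x of M is the join of the p_k, for
   k in S with phi_k x = 1, where the phi_k are the coordinate functionals of
   the splitting. So M is finite and distributive, and all four conditions
   hold: the identity is the sum of the rank-one maps that send x to p_k when
   phi_k x = 1 and to the bottom otherwise, and every such map lies in any
   nonzero ideal, as well as in the zero class of any nontrivial congruence. *)

Section DualBasis.
Variables (d : Order.disp_t) (M : tbLatticeType d) (K : finType).

(** A finite dual basis over the Boolean semifield: each [phi k] is a linear functional, and its
    value, as a scalar on [b k], becomes the filter of the join. *)
Record dual_basis (phi : K -> M -> bool) (b : K -> M) : Prop := DualBasis {
  dual_basis_bot : forall k, phi k \bot%O = false;
  dual_basis_join : forall k, {morph phi k : x y / Order.join x y >-> x || y};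
  dual_basis_expand : forall x, x = (\join_(k | phi k x) b k)%O }.

Variables (phi : K -> M -> bool) (b : K -> M).
Hypothesis phib : dual_basis phi b.

Lemma dual_basis_le k x : phi k x -> (b k <= x)%O.
Proof. by move=> kx; rewrite [leRHS](dual_basis_expand phib) joins_sup. Qed.

Lemma dual_basis_mono k x y : (x <= y)%O -> phi k x -> phi k y.
Proof. by move=> /join_r <- kx; rewrite (dual_basis_join phib) kx. Qed.

(** The expansion recovers [x] from the set of all [k] with [phi k x], and [K] has finitely many
    subsets. *)
Lemma dual_basis_finite : finite_set [set: M].
Proof.
pose f x := [ffun k => phi k x].
pose g (h : {ffun K -> bool}) := (\join_(k | h k) b k)%O.
suff -> : [set: M] = g @` [set: {ffun K -> bool}] by exact: finite_image.
apply/seteqP; split=> // x _; exists (f x) => //.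
rewrite /g [RHS](dual_basis_expand phib).
by apply: eq_bigl => k; rewrite ffunE.
Qed.

(** One inequality holds in every lattice. For the other, a [k] occurring in the expansion of the
    left side satisfies [phi k x] or [phi k y] by additivity, so [b k] is below [x] or [y], and also
    below [z]. *)
Lemma dual_basis_distributive : left_distributive (@Order.meet d M) Order.join.
Proof.
move=> x y z; apply/le_anti/andP; split; last first.
  by rewrite leUx !lexI !leIr !andbT !leIxl ?leUl ?leUr.
rewrite [leLHS](dual_basis_expand phib); apply/joinsP => k kxyz.
have kz : (b k <= z)%O.
  by apply: dual_basis_le; apply: dual_basis_mono kxyz; exact: leIr.
have := dual_basis_mono (leIl (Order.join x y) z) kxyz.
rewrite (dual_basis_join phib) => /orP[]/dual_basis_le bk.
  by rewrite lexUl // lexI bk.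
by rewrite lexUr // lexI bk.
Qed.

End DualBasis.

Section ProjectiveDualBasis.

Fact dsum_delta_finite (X : Type) (x : X) :
  finite_set [set y | (`[< y = x >] : Bsemifield) != 0].
Proof.
apply: sub_finite_set (finite_set1 x) => y /=.
by case: asboolP.
Qed.

Definition dsum_delta (X : Type) (x : X) : dsum Bsemifield X :=
  DSum (dsum_delta_finite x).

Lemma dsum_sumE (R : nzSemiRingType) (X I : Type) (r : seq I) (P : pred I)
    (F : I -> dsum R X) (x : X) :
  (\sum_(k <- r | P k) F k) x = \sum_(k <- r | P k) F k x.
Proof. exact: (big_morph (fun f : dsum R X => f x)). Qed.

(** The map [i] is additive, hence monotone, so the finite support of the image of the top contains
    the support of every [i m]. The coordinates in it, with the images under [p] of its basis
    vectors, form the dual basis. *)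
Lemma projective_dual_basis (d : Order.disp_t) (M : tbLatticeType d) :
  projective (R := Bsemifield) (join_semimod M) ->
  exists (K : finType) (phi : K -> M -> bool) (b : K -> M), dual_basis phi b.
Proof.
move=> [X [i [p ip]]].
have iD k :
    {morph (fun x : M => i x k : bool) : x y / Order.join x y >-> x || y}.
  by move=> x y; exact: (congr1 (fun f : dsum _ _ => f k) (raddfD i x y)).
have [s sE] : exists s : seq {classic X},
    [set x | i (\top%O : M) x != 0] = [set` s].
  by apply/finite_seqP; exact: dsum_finite.
have i_supp (m : M) x : i m x -> x \in (s : seq {classic X}).
  move=> imx; have : [set` s] x by rewrite -sE /= -(joinx1 m) iD imx.
  by [].
exists (seq_sub s), (fun (k : seq_sub s) (m : M) => i m (val k) : bool).
exists (fun k : seq_sub s => p (dsum_delta (val k : X))); split=> [k|k|m].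
- by rewrite -[\bot%O]/(0 : join_semimod M) raddf0.
- exact: iD.
have im : i m = \sum_(k : seq_sub s | i m (val k)) dsum_delta (val k : X).
  apply: dsum_eq => x; rewrite dsum_sumE.
  apply/idP/idP => [imx|].
    rewrite (bigD1 (SeqSub (i_supp m x imx))) //=.
    by rewrite asboolT.
  (* Read in [bool], the sum is a disjunction, so it is true only if some summand is. *)
  rewrite (big_morph (id : Bsemifield -> bool) (id1 := false) (op1 := orb)) //.
  by rewrite big_has_cond => /hasP[k _ /andP[imk /asboolP ->]].
by rewrite -[LHS](ip m) [in LHS]im raddf_sum.
Qed.

End ProjectiveDualBasis.

Lemma congruence_zero_class_ideal (R : pzSemiRingType) (E : R -> R -> Prop) :
  is_congruence E -> is_ideal [set x | E x 0].
Proof.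
move=> [Er _ _ ED EM]; split=> [|x y Ex Ey|r x Ex] /=; first exact: Er.
  by rewrite -[0]addr0; exact: ED.
by split; [rewrite -(mulr0 r)|rewrite -(mul0r r)]; exact: EM.
Qed.

Section RankOne.
Variables (d : Order.disp_t) (M : completeLatticeType d).

(** These are the complete homomorphisms from [M] to the Boolean semifield; an empty [A] forces
    [phi] to be false at the bottom. *)
Definition join_prime_pred (phi : M -> bool) : Prop :=
  forall A : set M, phi (cjoin A) <-> exists2 x, A x & phi x.

Lemma cjoin_le (A : set M) (y : M) :
  (cjoin A <= y)%O <-> forall x, A x -> (x <= y)%O.
Proof.
have [AU AL] := cjoin_supremums A.
split=> [Ay x Ax|]; last exact: AL.
exact: le_trans (AU x Ax) Ay.
Qed.

(** A join is below [a] exactly when all its members are. These functionals separate the points of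
    [M]. *)
Lemma join_prime_nle (a : M) : join_prime_pred (fun x => ~~ (x <= a)%O).
Proof.
move=> A; split=> [/negP Aa|[x Ax]]; last first.
  by apply: contra => /cjoin_le; apply.
apply: contrapT => nA; apply/Aa/cjoin_le => x Ax.
by apply: contrapT => /negP xa; apply: nA; exists x.
Qed.

(** Every join is a finite one here, so the empty and binary cases suffice. *)
Lemma join_prime_finite (phi : M -> bool) : finite_set [set: M] ->
    phi \bot%O = false -> {morph phi : x y / Order.join x y >-> x || y} ->
  join_prime_pred phi.
Proof.
move=> Mfin phi0 phiU A.
have [s ->] : exists s : seq M, A = [set` s].
  by apply/finite_seqP; exact: sub_finite_set Mfin.
have -> : cjoin [set` s] = (\join_(x <- s) x)%O.
  apply: cjoinP; split=> [x xs|y ys]; first exact: (joins_sup_seq _ xs).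
  by apply/joinsP_seq => x xs _; exact: ys.
rewrite (big_morph phi phiU phi0) big_has.
by split=> [/hasP[x]|[x xs phix]]; [exists x|apply/hasP; exists x].
Qed.

Section RankOneMap.
Variables (phi : M -> bool) (b : M).
Hypothesis phiP : join_prime_pred phi.

Let rank_one_fun x : M := if phi x then b else \bot%O.

Fact rank_one_cjoin (A : set M) :
  rank_one_fun (cjoin A) = cjoin (rank_one_fun @` A).
Proof.
apply/esym/cjoinP; split=> [_ [x Ax <-]|y yU]; rewrite /rank_one_fun.
  have [phix|_] := boolP (phi x); last exact: le0x.
  by rewrite ifT //; apply/phiP; exists x.
case: ifPn => [/phiP[x Ax phix]|_]; last exact: le0x.
by apply: yU; exists x => //; rewrite /rank_one_fun phix.
Qed.

Definition rank_one : CEnd M := MkCEnd rank_one_cjoin.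

End RankOneMap.

(** As for rank-one operators in linear algebra, the product is a scalar multiple of a rank-one map;
    the scalar is the functional of [join_prime_nle a] evaluated at [f y]. *)
Lemma rank_one_mul (phi : M -> bool) (phiP : join_prime_pred phi) (a b y : M)
    (f : CEnd M) :
  rank_one b (join_prime_nle a) * f * rank_one y phiP =
    if (f y <= a)%O then 0 else rank_one b phiP.
Proof.
apply: CEnd_eq => x /=; have [phix|/negPf phix] := boolP (phi x).
  by have [//|_] := boolP (f y <= a)%O; rewrite /= phix.
rewrite CEnd_bot le0x /=; have [//|_] := boolP (f y <= a)%O.
by rewrite /= phix.
Qed.

Lemma CEnd_sumE (I : Type) (r : seq I) (P : pred I) (F : I -> CEnd M) (x : M) :
  (\sum_(k <- r | P k) F k) x = (\join_(k <- r | P k) F k x)%O.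
Proof. exact: (big_morph (fun f : CEnd M => f x)). Qed.

Lemma CEnd_neqP (f g : CEnd M) : f <> g -> exists x, f x <> g x.
Proof.
move=> fg; apply: contrapT => nfg; apply: fg; apply: CEnd_eq => x.
by apply: contrapT => ?; apply: nfg; exists x.
Qed.

Variables (K : finType) (phi : K -> M -> bool) (p : K -> M).
Hypothesis phip : dual_basis phi p.

Lemma dual_basis_join_prime k : join_prime_pred (phi k).
Proof.
apply: join_prime_finite; first exact: dual_basis_finite phip.
  exact: dual_basis_bot phip k.
exact: dual_basis_join phip k.
Qed.

Lemma CEnd_one_sum : 1 = \sum_k rank_one (p k) (dual_basis_join_prime k).
Proof.
apply: CEnd_eq => x; rewrite CEnd_sumE /= [LHS](dual_basis_expand phip).
by rewrite [LHS]big_mkcond.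
Qed.

Lemma ideal_full (I : set (CEnd M)) : is_ideal I ->
  (forall k, I (rank_one (p k) (dual_basis_join_prime k))) -> I = [set: CEnd M].
Proof.
move=> [I0 ID IM] Ip; apply/seteqP; split=> // r _.
rewrite -[r]mulr1; apply: (IM r 1 _).1.
by rewrite CEnd_one_sum; apply: big_ind.
Qed.

Lemma dual_basis_ideal_simple : ideal_simple (CEnd M).
Proof.
move=> I Iid; have [I0 _ IM] := Iid.
have [[f If f0]|I00] := pselect (exists2 f, I f & f <> 0); last first.
  left; apply/seteqP; split=> [f If|_ ->] //=.
  by apply: contrapT => f0; apply: I00; exists f.
right; apply: ideal_full => // k.
have [y fy0] := CEnd_neqP f0.
(* With [a] the bottom, the scalar is 1 because [f y] is not the bottom. *)
have := rank_one_mul (dual_basis_join_prime k) \bot%O (p k) y f.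
rewrite lex0; case: eqP => // _ <-.
by apply: (IM _ _ _).2; apply: (IM _ _ _).1.
Qed.

Lemma dual_basis_congruence_simple : congruence_simple (CEnd M).
Proof.
move=> E Econg; have [Er Es Et _ EM] := Econg.
have [[f [g [Efg fg]]]|Ediag] := pselect (exists f g, E f g /\ f <> g);
    last first.
  left=> f g; split=> [Efg|->//].
  by apply: contrapT => fg; apply: Ediag; exists f, g.
(* Any two elements congruent to 0 are congruent to each other. *)
right; suff E0 : [set x | E x 0] = [set: CEnd M].
  have {}E0 x : E x 0 by have : [set: CEnd M] x by []; rewrite -E0.
  by move=> x y; apply: Et (E0 x) (Es _ _ (E0 y)).
(* By antisymmetry one of the two inequalities fails at [y]; symmetry of [E] allows swapping [f] and
   [g]. *)
have {f g Efg fg} [f [g [y [Efg fgy]]]] :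
    exists f g y, E f g /\ ~~ (f y <= g y)%O.
  have [y fgy] := CEnd_neqP fg.
  have [fy|fy] := boolP (f y <= g y)%O; last by exists f, g, y.
  exists g, f, y; split; first exact: Es.
  by apply/negP => gy; apply: fgy; apply/le_anti; rewrite fy.
apply: ideal_full; first exact: congruence_zero_class_ideal.
move=> k /=; set e := rank_one _ _.
(* Multiplying by rank-one maps on both sides turns f into e and g into 0. *)
have mulE := rank_one_mul (dual_basis_join_prime k) (g y) (p k) y.
have := mulE g; have := mulE f.
rewrite lexx (negPf fgy) -/e /= => <- <-.
exact: (EM _ _ _ _ (EM _ _ _ _ (Er _) Efg) (Er _)).
Qed.

End RankOne.

Theorem corollary3p9 (d : Order.disp_t) (M : completeLatticeType d)
    (hproj : projective (R := Bsemifield) (join_semimod M)) :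
  [<-> ideal_simple (CEnd M);
       semiring_simple (CEnd M);
       congruence_simple (CEnd M);
       finite_distributive M].
Proof.
have [K [phi [p phip]]] := projective_dual_basis hproj.
have ids := dual_basis_ideal_simple phip.
have cgs := dual_basis_congruence_simple phip.
have fd : finite_distributive M.
  by split; [exact: dual_basis_finite phip|exact: dual_basis_distributive phip].
by tfae.
Qed.
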